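(* Let $A=\sigma(R)\langle x_1,\dots,x_n\rangle$ ($n\ge 1$) be a bijective skew $PBW$ extension of a left noetherian domain $R$. Then the following hold. (i) Let $f,g,h\in A$ and $Z=(z_1,\dots,z_n)\in R^n$. (a) If $f(Z)=0=g(Z)$, then $(f+g)(Z)=0$. (b) $V(f)\subseteq V(gfh)$. (ii) Let $I:=Ag$ be a left principal ideal of $A$. Then $V(I)=V(g)$. The same is true for right principal ideals ($I=gA$) and two-sided principal ideals ($I=AgA$) of $A$. (iii) (a) $V(0)=R^n$. (b) $\emptyset$ is algebraic. (c) If $S\subseteq T\subseteq A$, then $V(T)\subseteq V(S)$. (d) If $S\subseteq A$, then $V(S)=V(AS)=V(SA)=V(ASA)$. (e) $V(I)\cup V(J)\subseteq V(I\cap J)$, where $I,J$ are left (respectively right, two-sided) ideals of $A$. (f) $V(\sum_{k\in\mathcal{K}}I_k)=\bigcap_{k\in\mathcal{K}}V(I_k)$, where $(I_k)_{k\in\mathcal{K}}$ is a family of left (respectively right, two-sided) ideals of $A$. (h) For $Z=(z_1,\dots,z_n)\in R^n$, $\{Z\}\subseteq V(\langle Z\rangle)$. (iv) Let $X\subseteq R^n$. Then $I(X):=\{g\in A\mid g(Z)=0\text{ for every }Z\in X\}$ is a two-sided ideal of $A$ (called the ideal of points of $X$). Moreover: (a) $I(\emptyset)=A$. (b) For $X,Y\subseteq R^n$, $X\subseteq Y$ implies $I(Y)\subseteq I(X)$. (c) If $I$ is a left (right, two-sided) ideal of $A$, then $I\subseteq I(V(I))$. (d) $X\subseteq V(I(X))$.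 (e) If $g\in A$, then $V(I(V(g)))=V(g)$. Thus, if $X=V(g)$, then $V(I(X))=X$. (f) $I(V(I(X)))=I(X)$. (g) $I(\bigcup_{k\in\mathcal{K}}X_k)=\bigcap_{k\in\mathcal{K}}I(X_k)$ for any family $(X_k)_{k\in\mathcal{K}}$ of subsets of $R^n$. (h) For $Z=(z_1,\dots,z_n)\in R^n$, $I(\{Z\})=\langle Z\rangle$.
   Context: Rings are associative with $1$, not necessarily commutative. Skew $PBW$ extension: let $R\subseteq A$ be rings. $A$ is a skew $PBW$ extension of $R$, written $A=\sigma(R)\langle x_1,\dots,x_n\rangle$, if there are $x_1,\dots,x_n\in A$ such that: $A$ is a free left $R$-module with basis $\mathrm{Mon}(A)=\{x_1^{\alpha_1}\cdots x_n^{\alpha_n}\mid \alpha\in\mathbb{N}^n\}$ (with $0\in\mathbb{N}$); for every $1\le i\le n$ and $r\in R-\{0\}$ there is $c_{i,r}\in R-\{0\}$ with $x_ir-c_{i,r}x_i\in R$; for all $1\le i,j\le n$ there is $c_{i,j}\in R-\{0\}$ with $x_jx_i-c_{i,j}x_ix_j\in R+Rx_1+\cdots+Rx_n$. Then for each $i$ there are an injective ring endomorphism $\sigma_i:R\to R$ and a $\sigma_i$-derivation $\delta_i$ of $R$ with $x_ir=\sigma_i(r)x_i+\delta_i(r)$ for all $r\in R$. $A$ is bijective if every $\sigma_i$ is bijective and every $c_{i,j}$ is invertible. For $Z=(z_1,\dots,z_n)\in R^n$, $\langle Z\rangle:=\langle x_1-z_1,\dots,x_n-z_n\rangle$ denotes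 the two-sided ideal of $A$ generated by $x_1-z_1,\dots,x_n-z_n$. For $f\in A$, $Z$ is a root of $f$, written $f(Z)=0$, if and only if $f\in\langle Z\rangle$. The vanishing set of $f$ is $V(f):=\{Z\in R^n\mid f(Z)=0\}$, and for $S\subseteq A$, $V(S):=\{Z\in R^n\mid f(Z)=0\text{ for every }f\in S\}$. A subset $X\subseteq R^n$ is algebraic if either $X=R^n$ or there exists $0\ne g\in A$ with $X\subseteq V(g)$ (inclusion, not equality). For $S\subseteq A$, $AS$, $SA$, $ASA$ denote respectively the left, right, two-sided ideal of $A$ generated by $S$. *)

(* Defs.v *)
From HB Require Import structures.
From mathcomp Require Import all_boot all_order all_algebra.
From mathcomp Require Import boolp classical_sets.

Set Implicit Arguments.
Unset Strict Implicit.
Unset Printing Implicit Defensive.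

Import GRing.Theory.
Local Open Scope classical_set_scope.
Local Open Scope ring_scope.

(* Rings are pzRingType: not necessarily commutative, 1 = 0 not excluded.
   Closure under opposites follows from absorption of -1. *)
Definition left_ideal (A : pzRingType) (I : set A) : Prop :=
  [/\ I 0, (forall f g, I f -> I g -> I (f + g))
    & (forall a f, I f -> I (a * f))].

Definition right_ideal (A : pzRingType) (I : set A) : Prop :=
  [/\ I 0, (forall f g, I f -> I g -> I (f + g))
    & (forall a f, I f -> I (f * a))].

Definition two_sided_ideal (A : pzRingType) (I : set A) : Prop :=
  left_ideal I /\ right_ideal I.

(* The ideals AS, SA and ASA. *)
Definition left_gen (A : pzRingType) (S : set A) : set A :=
  smallest (@left_ideal A) S.
Definition right_gen (A : pzRingType) (S : set A) : set A :=
  smallest (@right_ideal A) S.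
Definition two_sided_gen (A : pzRingType) (S : set A) : set A :=
  smallest (@two_sided_ideal A) S.

(* Finite sums of elements of the I k; the same k may be used repeatedly. *)
Definition ideal_sum (A : pzRingType) (K : Type) (I : K -> set A) : set A :=
  [set f | exists (m : nat) (k : 'I_m -> K) (a : 'I_m -> A),
     (forall j, I (k j) (a j)) /\ f = \sum_(j < m) a j].

Definition is_domain (R : pzRingType) : Prop :=
  (1 : R) <> 0 /\ (forall a b : R, a * b = 0 -> a = 0 \/ b = 0).

Definition left_noetherian (R : pzRingType) : Prop :=
  forall I : nat -> set R,
    (forall k, left_ideal (I k)) -> (forall k, I k `<=` I k.+1) ->
    exists m, forall k, (m <= k)%N -> I k = I m.

Definition invertible (R : pzRingType) (c : R) : Prop :=
  exists d, c * d = 1 /\ d * c = 1.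

Definition skew_derivation (R : pzRingType) (sigma : {rmorphism R -> R})
    (delta : R -> R) : Prop :=
  (forall a b, delta (a + b) = delta a + delta b) /\
  (forall a b, delta (a * b) = sigma a * delta b + delta a * b).

(* Below, the inclusion of rings of R in A is an injective ring morphism
   iota : R -> A, and A is a left R-module through r . f = iota r * f. *)

(* The big product is taken in increasing order of i, so this is the standard
   monomial x_0 ^ alpha_0 * ... * x_(n-1) ^ alpha_(n-1). *)
Definition monomial (A : pzRingType) (n : nat) (x : 'I_n -> A)
    (alpha : {ffun 'I_n -> nat}) : A :=
  \prod_(i < n) x i ^+ alpha i.

Definition left_free_basis (R A : pzRingType) (iota : {rmorphism R -> A})
    (T : eqType) (e : T -> A) : Prop :=
  (forall f : A, exists (s : seq T) (c : T -> R),
     f = \sum_(t <- s) iota (c t) * e t) /\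
  (forall (s : seq T) (c : T -> R), uniq s ->
     \sum_(t <- s) iota (c t) * e t = 0 -> forall t, t \in s -> c t = 0).

(* x_j x_i - c x_i x_j lies in R + R x_1 + ... + R x_n. *)
Definition commutation_coef (R A : pzRingType) (iota : {rmorphism R -> A})
    (n : nat) (x : 'I_n -> A) (i j : 'I_n) (c : R) : Prop :=
  exists (d0 : R) (d : 'I_n -> R),
    x j * x i - iota c * x i * x j = iota d0 + \sum_(k < n) iota (d k) * x k.

Definition skew_PBW (R A : pzRingType) (iota : {rmorphism R -> A})
    (n : nat) (x : 'I_n -> A) : Prop :=
  [/\ injective iota,
      left_free_basis iota (monomial x),
      (forall (i : 'I_n) (r : R), r <> 0 ->
         exists c d : R, c <> 0 /\ x i * iota r - iota c * x i = iota d)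
    & (forall i j : 'I_n,
         exists c : R, c <> 0 /\ commutation_coef iota x i j c)].

(* sigma_i and delta_i are determined by the relation x_i r = sigma_i(r) x_i +
   delta_i(r), since 1 and x_i belong to a basis; over a domain the c_{i,j} are
   likewise determined.  Hence it is harmless to quantify them existentially. *)
Definition bijective_skew_PBW (R A : pzRingType) (iota : {rmorphism R -> A})
    (n : nat) (x : 'I_n -> A) : Prop :=
  [/\ skew_PBW iota x,
      (forall i : 'I_n, exists (sigma : {rmorphism R -> R}) (delta : R -> R),
         [/\ skew_derivation sigma delta,
             (forall r, x i * iota r = iota (sigma r) * x i + iota (delta r))
           & bijective sigma])
    & (forall i j : 'I_n, exists c : R,
         [/\ c <> 0, commutation_coef iota x i j c & invertible c])].

(* The two-sided ideal <Z> = <x_1 - z_1, ..., x_n - z_n>. *)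
Definition point_ideal (R A : pzRingType) (iota : {rmorphism R -> A})
    (n : nat) (x : 'I_n -> A) (Z : 'rV[R]_n) : set A :=
  two_sided_gen [set x i - iota (Z ord0 i) | i in [set: 'I_n]].

(* f(Z) = 0. *)
Definition is_root (R A : pzRingType) (iota : {rmorphism R -> A})
    (n : nat) (x : 'I_n -> A) (f : A) (Z : 'rV[R]_n) : Prop :=
  point_ideal iota x Z f.

(* V(f) for an element f. *)
Definition vanish1 (R A : pzRingType) (iota : {rmorphism R -> A})
    (n : nat) (x : 'I_n -> A) (f : A) : set 'rV[R]_n :=
  [set Z | is_root iota x f Z].

(* V(S) for a subset S. *)
Definition vanish (R A : pzRingType) (iota : {rmorphism R -> A})
    (n : nat) (x : 'I_n -> A) (S : set A) : set 'rV[R]_n :=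
  [set Z | forall f, S f -> is_root iota x f Z].

(* Inclusion in some V(g), not equality. *)
Definition algebraic (R A : pzRingType) (iota : {rmorphism R -> A})
    (n : nat) (x : 'I_n -> A) (X : set 'rV[R]_n) : Prop :=
  X = setT \/ exists g : A, g <> 0 /\ X `<=` vanish1 iota x g.

(* The ideal of points I(X). *)
Definition points_ideal (R A : pzRingType) (iota : {rmorphism R -> A})
    (n : nat) (x : 'I_n -> A) (X : set 'rV[R]_n) : set A :=
  [set g | forall Z, X Z -> is_root iota x g Z].

(* Main.v *)
(* A set S vanishes at Z exactly when S is contained in the two-sided ideal <Z>.
   Hence V does not distinguish S from the left, right or two-sided ideal it
   generates, and V and I form a Galois connection between subsets of A and
   subsets of R^n. *)
Require Import Defs.
From HB Require Import structures.
From mathcomp Require Import all_boot all_order all_algebra.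
From mathcomp Require Import boolp classical_sets.

Set Implicit Arguments.
Unset Strict Implicit.
Unset Printing Implicit Defensive.

Import GRing.Theory.
Local Open Scope classical_set_scope.
Local Open Scope ring_scope.

Lemma two_sided_ideal_intro (A : pzRingType) (I : set A) :
    I 0 -> (forall f g, I f -> I g -> I (f + g)) ->
    (forall a f, I f -> I (a * f)) -> (forall a f, I f -> I (f * a)) ->
  two_sided_ideal I.
Proof. by move=> I0 ID IMl IMr; split; split. Qed.

(** An intersection of two-sided ideals is again one: each closure rule is checked inside an
    arbitrary two-sided ideal [P] containing [S]. *)
Lemma two_sided_gen_ideal (A : pzRingType) (S : set A) :
  two_sided_ideal (two_sided_gen S).
Proof.
apply: two_sided_ideal_intro => [P|f g Sf Sg P|a f Sf P|a f Sf P] SP;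
  have [[[P0 PD PMl] [_ _ PMr]] _] := SP => //.
- by apply: PD; [exact: Sf | exact: Sg].
- by apply: PMl; exact: Sf.
- by apply: PMr; exact: Sf.
Qed.

Section Roots.
Variables (R A : pzRingType) (iota : {rmorphism R -> A}).
Variables (n : nat) (x : 'I_n -> A).
Implicit Types (f g : A) (Z : 'rV[R]_n) (S : set A) (X : set 'rV[R]_n).

(** Being a root means membership in this ideal rather than evaluation at a point, so the rules
    below for sums and multiples are read off from its closure properties. *)
Lemma point_ideal_two_sided Z : two_sided_ideal (point_ideal iota x Z).
Proof. exact: two_sided_gen_ideal. Qed.

Lemma is_root0 Z : is_root iota x 0 Z.
Proof. by have [[]] := point_ideal_two_sided Z. Qed.

Lemma is_rootD f g Z :
  is_root iota x f Z -> is_root iota x g Z -> is_root iota x (f + g) Z.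
Proof. by have [[_ D _] _] := point_ideal_two_sided Z; exact: D. Qed.

Lemma is_rootMl a f Z : is_root iota x f Z -> is_root iota x (a * f) Z.
Proof. by have [[_ _ M] _] := point_ideal_two_sided Z; exact: M. Qed.

Lemma is_rootMr a f Z : is_root iota x f Z -> is_root iota x (f * a) Z.
Proof. by have [_ [_ _ M]] := point_ideal_two_sided Z; exact: M. Qed.

Lemma is_root_sum m (a : 'I_m -> A) Z :
  (forall j, is_root iota x (a j) Z) -> is_root iota x (\sum_(j < m) a j) Z.
Proof.
move=> Ha; elim/big_ind: _ => [|f g|j _]; [exact: is_root0 | exact: is_rootD | exact: Ha].
Qed.

(** Lets the claims about principal ideals follow from those about generating sets. *)
Lemma vanish_set1 g : vanish iota x [set g] = vanish1 iota x g.
Proof. by apply/seteqP; split=> Z => [|Hg f ->]; [apply|]. Qed.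

(** Treats left, right and two-sided generation at once. If [S] vanishes at [Z], then the ideal of
    [Z] is a set of class [C] containing [S], so it contains the smallest such set. *)
Lemma vanish_smallest (C : set A -> Prop) S :
    (forall P, two_sided_ideal P -> C P) ->
  vanish iota x (smallest C S) = vanish iota x S.
Proof.
move=> CP; apply/seteqP; split=> Z HZ f Sf; first exact: HZ (sub_gen_smallest Sf).
by apply: Sf; split=> //; apply/CP/two_sided_gen_ideal.
Qed.

Lemma vanish_left_gen S : vanish iota x (left_gen S) = vanish iota x S.
Proof. by apply: vanish_smallest => P []. Qed.

Lemma vanish_right_gen S : vanish iota x (right_gen S) = vanish iota x S.
Proof. by apply: vanish_smallest => P []. Qed.

Lemma vanish_two_sided_gen S : vanish iota x (two_sided_gen S) = vanish iota x S.
Proof. exact: vanish_smallest. Qed.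

Lemma vanish_ideal_sum (K : Type) (I : K -> set A) :
  vanish iota x (ideal_sum I) = \bigcap_(k in setT) vanish iota x (I k).
Proof.
apply/seteqP; split=> [Z HZ k _ f If | Z HZ _ [m [k [a [Ia ->]]]]].
  (* An element of [I k] is a sum with one term, so [I k] lies in the sum. *)
  by apply: HZ; exists 1%N, (fun=> k), (fun=> f); rewrite big_ord1.
by apply: is_root_sum => j; exact: HZ (Ia j).
Qed.

Lemma points_ideal_two_sided X : two_sided_ideal (points_ideal iota x X).
Proof.
apply: two_sided_ideal_intro => [Z _|f g Xf Xg Z XZ|a f Xf Z XZ|a f Xf Z XZ].
- exact: is_root0.
- by apply: is_rootD; [exact: Xf | exact: Xg].
- by apply: is_rootMl; exact: Xf.
- by apply: is_rootMr; exact: Xf.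
Qed.

Lemma sub_vanish_points_ideal X : X `<=` vanish iota x (points_ideal iota x X).
Proof. by move=> Z XZ f; apply. Qed.

Lemma sub_points_ideal_vanish S : S `<=` points_ideal iota x (vanish iota x S).
Proof. by move=> f Sf Z; apply. Qed.

(** The usual triangle identity of a Galois connection: one inclusion is the unit on subsets of [A],
    the other comes from reversing the unit [sub_vanish_points_ideal]. *)
Lemma points_ideal_vanishK X :
  points_ideal iota x (vanish iota x (points_ideal iota x X))
  = points_ideal iota x X.
Proof.
apply/seteqP; split; last exact: sub_points_ideal_vanish.
by move=> f Hf Z /sub_vanish_points_ideal; exact: Hf.
Qed.

Lemma vanish_points_idealK g :
  vanish iota x (points_ideal iota x (vanish1 iota x g)) = vanish1 iota x g.
Proof.
apply/seteqP; split; last exact: sub_vanish_points_ideal.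
(* The element [g] itself vanishes on its own vanishing set, so the hypothesis on [Z] is applied to
   [g]. *)
by move=> Z; apply.
Qed.

End Roots.

Theorem theorem4p4 (R A : pzRingType) (iota : {rmorphism R -> A})
    (n : nat) (x : 'I_n -> A)
    (n_ge1 : (1 <= n)%N)
    (R_domain : is_domain R)
    (R_noeth : left_noetherian R)
    (A_PBW : bijective_skew_PBW iota x) :
  (* (i) *)
  ((forall (f g : A) (Z : 'rV[R]_n),
      is_root iota x f Z -> is_root iota x g Z -> is_root iota x (f + g) Z) /\
   (forall f g h : A, vanish1 iota x f `<=` vanish1 iota x (g * f * h))) /\
  (* (ii) *)
  ((forall g : A, vanish iota x (left_gen [set g]) = vanish1 iota x g) /\
   (forall g : A, vanish iota x (right_gen [set g]) = vanish1 iota x g) /\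
   (forall g : A, vanish iota x (two_sided_gen [set g]) = vanish1 iota x g)) /\
  (* (iii) *)
  (vanish1 iota x 0 = setT /\
   algebraic iota x set0 /\
   (forall S T : set A, S `<=` T -> vanish iota x T `<=` vanish iota x S) /\
   (forall S : set A,
      [/\ vanish iota x S = vanish iota x (left_gen S),
          vanish iota x (left_gen S) = vanish iota x (right_gen S)
        & vanish iota x (right_gen S) = vanish iota x (two_sided_gen S)]) /\
   (forall I J : set A,
      [\/ left_ideal I /\ left_ideal J,
          right_ideal I /\ right_ideal J
        | two_sided_ideal I /\ two_sided_ideal J] ->
      vanish iota x I `|` vanish iota x J `<=` vanish iota x (I `&` J)) /\
   (forall (K : Type) (I : K -> set A),
      [\/ (forall k, left_ideal (I k)),
          (forall k, right_ideal (I k))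
        | (forall k, two_sided_ideal (I k))] ->
      vanish iota x (ideal_sum I) = \bigcap_(k in setT) vanish iota x (I k)) /\
   (forall Z : 'rV[R]_n, [set Z] `<=` vanish iota x (point_ideal iota x Z))) /\
  (* (iv) *)
  ((forall X : set 'rV[R]_n, two_sided_ideal (points_ideal iota x X)) /\
   points_ideal iota x set0 = setT /\
   (forall X Y : set 'rV[R]_n,
      X `<=` Y -> points_ideal iota x Y `<=` points_ideal iota x X) /\
   (forall I : set A,
      [\/ left_ideal I, right_ideal I | two_sided_ideal I] ->
      I `<=` points_ideal iota x (vanish iota x I)) /\
   (forall X : set 'rV[R]_n, X `<=` vanish iota x (points_ideal iota x X)) /\
   ((forall g : A,
       vanish iota x (points_ideal iota x (vanish1 iota x g))
       = vanish1 iota x g) /\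
    (forall (X : set 'rV[R]_n) (g : A),
       X = vanish1 iota x g -> vanish iota x (points_ideal iota x X) = X)) /\
   (forall X : set 'rV[R]_n,
      points_ideal iota x (vanish iota x (points_ideal iota x X))
      = points_ideal iota x X) /\
   (forall (K : Type) (X : K -> set 'rV[R]_n),
      points_ideal iota x (\bigcup_(k in setT) X k)
      = \bigcap_(k in setT) points_ideal iota x (X k)) /\
   (forall Z : 'rV[R]_n, points_ideal iota x [set Z] = point_ideal iota x Z)).
Proof.
have [R1 _] := R_domain; have [[iota_inj _ _ _] _ _] := A_PBW.
split; [|split; [|split]].
- split=> [f g Z|f g h Z]; first exact: is_rootD.
  by move=> /(is_rootMl g) /(is_rootMr h).
- split; [|split] => g; rewrite -vanish_set1.
  + exact: vanish_left_gen.
  + exact: vanish_right_gen.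
  + exact: vanish_two_sided_gen.
- split; [|split; [|split; [|split; [|split; [|split]]]]].
  + by apply/seteqP; split=> [//|Z _]; exact: is_root0.
  (* The empty set lies in every vanishing set, so any nonzero element is a witness; [1] is nonzero
     in [A] because it is nonzero in the domain [R] and [iota] is injective. *)
  + right; exists 1; split=> //.
    by rewrite -(rmorph1 iota) -(rmorph0 iota) => /iota_inj.
  + by move=> S T ST Z HZ f /ST; exact: HZ.
  + by move=> S; rewrite vanish_left_gen vanish_right_gen vanish_two_sided_gen.
  (* An element of the intersection lies in whichever of [I] and [J] vanishes at [Z]. *)
  + by move=> I J _ Z [HZ f [If _]|HZ f [_ Jf]]; exact: HZ.
  + by move=> K I _; exact: vanish_ideal_sum.
  + by move=> Z _ -> f.
- split; first exact: points_ideal_two_sided.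
  split; first by apply/seteqP; split=> [//|f _ Z []].
  split; first by move=> X Y XY f Hf Z /XY; exact: Hf.
  split; first by move=> I _; exact: sub_points_ideal_vanish.
  split; first exact: sub_vanish_points_ideal.
  split.
    by split=> [g|_ g ->]; exact: vanish_points_idealK.
  split; first exact: points_ideal_vanishK.
  split=> [K X|Z].
    apply/seteqP; split=> [f Hf k _ Z XZ|f Hf Z [k _ XZ]].
      by apply: Hf; exists k.
    exact: Hf XZ.
  (* Vanishing at the single point [Z] is, by definition, membership in its ideal. *)
  by apply/seteqP; split=> [f Hf|f Hf _ ->]; [exact: Hf |].
Qed.
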